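(* The logic $\mathsf{M^{+}Grz}$ has the finite model property: if $\mathsf{M^{+}Grz}\not\vdash\varphi$, then there is a finite $\mathsf{M^{+}Grz}$-frame $\mathfrak{F}$ with $\mathfrak{F}\not\vDash\varphi$.
   Context: $\mathcal{ML}_\forall$ is the classical propositional language with two unary modalities $\Box$ and $\forall$; $\exists\varphi$ abbreviates $\neg\forall\neg\varphi$ and $\blacksquare\varphi$ abbreviates $\Box\forall\varphi$. $\mathsf{MK}$ is the smallest set of $\mathcal{ML}_\forall$-formulas containing all classical tautologies, $\Box(p\to q)\to(\Box p\to\Box q)$, the $\mathsf{S5}$-axioms for $\forall$ (namely $\forall p\to p$, $\forall p\to\forall\forall p$, $\neg\forall p\to\forall\neg\forall p$, $\forall(p\to q)\to(\forall p\to\forall q)$), and $\Box\forall p\to\forall\Box p$, and closed under substitution, modus ponens, $\Box$-necessitation and $\forall$-necessitation. An mm-logic is an extension of $\mathsf{MK}$ closed under these rules. $\mathsf{MGrz}$ is the least mm-logic containing $\Box p\to p$, $\Box p\to\Box\Box p$ and $\mathsf{grz}=\Box(\Box(p\to\Box p)\to p)\to p$. $\mathsf{M^{+}Grz}$ is the least mm-logic containing $\mathsf{MGrz}$ and $\mathsf{M_\Box Cas}:\ \blacksquare\big(\Box(\Box p\to\blacksquare p)\to\blacksquare p\big)\to\blacksquare p$. An augmented Kripke frame is $\mathfrak{F}=(W,R,E)$ with $W$ nonempty, $R$ a binary relation on $W$, and $E$ an equivalence relation on $W$ satisfying commutativity: if $xEy$ and $yRz$, then there is $w$ with $xRw$ and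 $wEz$. A valuation assigns subsets of $W$ to propositional letters; $\Box$ is interpreted by $R$ ($x\vDash\Box\psi$ iff $y\vDash\psi$ for all $y$ with $xRy$), $\forall$ by $E$ ($x\vDash\forall\psi$ iff $y\vDash\psi$ for all $y$ with $xEy$), and Boolean connectives classically. $\mathfrak{F}\vDash\varphi$ means $\varphi$ is true at all points under all valuations. An $\mathsf{M^{+}Grz}$-frame is an augmented Kripke frame validating $\mathsf{M^{+}Grz}$ (for finite frames: $R$ is a partial order and $\mathfrak{F}\vDash\mathsf{M_\Box Cas}$). *)

(* Defs.v *)
From Stdlib Require Import RelationClasses.
From mathcomp Require Import all_boot.

Set Implicit Arguments.
Unset Strict Implicit.
Unset Printing Implicit Defensive.

(* [Bot] and [Imp] are the primitive Boolean connectives; the others are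
   classical abbreviations.  [All] is the modality written as a universal
   quantifier. *)
Inductive form : Type :=
| Var (n : nat)
| Bot
| Imp (a b : form)
| Box (a : form)
| All (a : form).

Definition Neg (a : form) : form := Imp a Bot.
Definition BlackBox (a : form) : form := Box (All a).

Fixpoint subst (s : nat -> form) (a : form) : form :=
  match a with
  | Var n => s n
  | Bot => Bot
  | Imp b c => Imp (subst s b) (subst s c)
  | Box b => Box (subst s b)
  | All b => All (subst s b)
  end.

(* Classical truth value, where the letters and the formulas beginning with a
   modality are the atoms: a formula is a [tautology] iff it is a substitution
   instance of a tautology of classical propositional logic. *)
Fixpoint truth (v : form -> bool) (a : form) : bool :=
  match a with
  | Bot => false
  | Imp b c => truth v b ==> truth v c
  | _ => v a
  end.

Definition tautology (a : form) : Prop := forall v, truth v a.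

Definition p : form := Var 0.
Definition q : form := Var 1.

Inductive MK_axiom : form -> Prop :=
| MK_taut a : tautology a -> MK_axiom a
| MK_boxK : MK_axiom (Imp (Box (Imp p q)) (Imp (Box p) (Box q)))
| MK_allT : MK_axiom (Imp (All p) p)
| MK_all4 : MK_axiom (Imp (All p) (All (All p)))
| MK_all5 : MK_axiom (Imp (Neg (All p)) (All (Neg (All p))))
| MK_allK : MK_axiom (Imp (All (Imp p q)) (Imp (All p) (All q)))
| MK_comm : MK_axiom (Imp (Box (All p)) (All (Box p))).

Record closed_under_rules (L : form -> Prop) : Prop := {
  closed_subst : forall s a, L a -> L (subst s a);
  closed_mp : forall a b, L (Imp a b) -> L a -> L b;
  closed_box_nec : forall a, L a -> L (Box a);
  closed_all_nec : forall a, L a -> L (All a)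
}.

Definition MK (a : form) : Prop :=
  forall L : form -> Prop,
    (forall b, MK_axiom b -> L b) -> closed_under_rules L -> L a.

Definition mm_logic (L : form -> Prop) : Prop :=
  (forall a, MK a -> L a) /\ closed_under_rules L.

Definition least_mm_logic (Gamma : form -> Prop) (a : form) : Prop :=
  forall L : form -> Prop,
    mm_logic L -> (forall b, Gamma b -> L b) -> L a.

Definition grz : form := Imp (Box (Imp (Box (Imp p (Box p))) p)) p.

Definition MBoxCas : form :=
  Imp (BlackBox (Imp (Box (Imp (Box p) (BlackBox p))) (BlackBox p)))
      (BlackBox p).

Inductive MGrz_axiom : form -> Prop :=
| MGrz_T : MGrz_axiom (Imp (Box p) p)
| MGrz_4 : MGrz_axiom (Imp (Box p) (Box (Box p)))
| MGrz_grz : MGrz_axiom grz.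

Definition MGrz : form -> Prop := least_mm_logic MGrz_axiom.

Definition MplusGrz : form -> Prop :=
  least_mm_logic (fun a => MGrz a \/ a = MBoxCas).

Record augmented_frame (W : Type) : Type := {
  frame_nonempty : inhabited W;
  frame_R : W -> W -> Prop;
  frame_E : W -> W -> Prop;
  frame_E_equiv : Equivalence frame_E;
  frame_comm : forall x y z,
    frame_E x y -> frame_R y z -> exists w, frame_R x w /\ frame_E w z
}.

Fixpoint sat (W : Type) (F : augmented_frame W) (V : nat -> W -> Prop)
    (x : W) (a : form) : Prop :=
  match a with
  | Var n => V n x
  | Bot => False
  | Imp b c => sat F V x b -> sat F V x c
  | Box b => forall y, frame_R F x y -> sat F V y b
  | All b => forall y, frame_E F x y -> sat F V y b
  end.

Definition valid (W : Type) (F : augmented_frame W) (a : form) : Prop :=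
  forall (V : nat -> W -> Prop) (x : W), sat F V x a.

Definition MplusGrz_frame (W : Type) (F : augmented_frame W) : Prop :=
  forall a, MplusGrz a -> valid F a.

(* Main.v *)
Require Import Defs.
From Stdlib Require Import RelationClasses.
From HB Require Import structures.
From mathcomp Require Import all_boot.
From mathcomp Require Import boolp.

Set Implicit Arguments.
Unset Strict Implicit.
Unset Printing Implicit Defensive.

(** A formula [phi] outside the logic is refuted in the canonical model, which is
    infinite.  Only finitely much of it matters for [phi]: a point is recorded
    by its type, the set of subformulas of [phi] true at it, and an [E]-class by
    its cluster type, the set of types of its points.  The finite frame has as
    points the pairs of a realized cluster type and a type in it, two points
    being [E]-related when their cluster types agree.

    On finite frames [grz] and [MBoxCas] amount to two conditions: [R] is a
    partial order, and [x R y] together with [x E y] forces [x = y].  Both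
    follow if every proper [R]-step strictly lowers a rank attached to cluster
    types; so every refuted [Box b] must be given a witness of smaller rank, or
    the point itself.  For this one realizes each cluster type by a good
    [E]-class, found above any realization ([exists_good]):
    - every point of it is final, that is, its successors of the same cluster
      type have its own type.  The axiom [MBoxCas] is what makes all points of
      one [E]-class final at once ([exists_all_final]), while [grz] yields final
      points one at a time ([exists_final]);
    - once the cluster type is left, it never recurs, by [grz] again.

    The rank of a cluster type is the least number of cluster types reachable
    from an [E]-class realizing it; a good class attains it ([exists_rank]).  A
    successor of a final point that refutes [b], while the point satisfies [b],
    lies in another cluster type, from which the former one is unreachable, so
    that its rank is smaller ([node_box_witness]).

    A proper step of the finite frame is required to preserve boxed formulas
    and to lower the rank; the steps need not come from steps between the
    chosen good classes, whose representatives may be changed freely at every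
    stage.  The truth lemma [node_truth] then concludes. *)

(** * Soundness for ranked frames *)

Section Soundness.

Variables (W : Type) (F : augmented_frame W).

Lemma sat_subst (V : nat -> W -> Prop) s a x :
  sat F V x (subst s a) <-> sat F (fun n y => sat F V y (s n)) x a.
Proof.
elim: a x => //= [b IHb c IHc|b IHb|b IHb] x.
- by rewrite IHb IHc.
- by split=> h y /h /IHb.
- by split=> h y /h /IHb.
Qed.

Lemma closed_valid : closed_under_rules (valid F).
Proof.
split=> [s a h V x|a b hab ha V x|a h V x y _|a h V x y _].
- exact/sat_subst/h.
- exact/hab/ha.
- exact: h.
- exact: h.
Qed.

Lemma sat_truth (V : nat -> W -> Prop) x a :
  truth (fun b => `[< sat F V x b >]) a = `[< sat F V x a >].
Proof.
elim: a => //= [|b -> c ->]; first by apply/esym/asboolP.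
by rewrite asbool_imply.
Qed.

Lemma MK_sound a : MK a -> valid F a.
Proof.
have [Er Es Et] := frame_E_equiv F.
apply=> [b|]; last exact: closed_valid.
case=> [{}b tb| | | | | |] V x /=.
- by apply/asboolP; rewrite -sat_truth.
- by move=> h hp y Rxy; apply/(h y Rxy)/hp.
- exact.
- by move=> h y Exy z Eyz; apply/h/(Et _ _ _ Exy).
- move=> h y Exy hy; apply: h => z Exz; apply/hy/(Et _ _ _ _ Exz).
  exact: Es.
- by move=> h hp y Exy; apply/(h y Exy)/hp.
- move=> h y Exy z Ryz.
  by have [w [Rxw Ewz]] := frame_comm Exy Ryz; apply: h Ewz.
Qed.

(** A rank that strictly decreases along proper [R]-steps and is constant on
    [E]-classes makes the frame a partial order without infinite ascending
    chains, in which no point has a proper [R]-successor in its own [E]-class;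
    this last property is what [MBoxCas] expresses. *)
Variable rank : W -> nat.
Hypothesis R_refl : Reflexive (frame_R F).
Hypothesis R_trans : Transitive (frame_R F).
Hypothesis rank_E : forall x y, frame_E F x y -> rank x = rank y.
Hypothesis rank_R :
  forall x y, frame_R F x y -> x = y \/ (rank y < rank x)%N.

Lemma grz_ranked : valid F grz.
Proof.
move=> V x /=; have [n] := ubnP (rank x); elim: n x => // n IH x ltn h.
have up y : frame_R F x y -> (rank y < rank x)%N -> V 0 y.
  move=> Rxy ltyx; apply: IH => [|z Ryz].
    exact: leq_trans ltyx _.
  exact/h/(R_trans Rxy Ryz).
apply: h => [|y Rxy py z Ryz]; first exact: R_refl.
have [<- //|ltzy] := rank_R Ryz.
apply: up; first exact: R_trans Ryz.
by have [->//|ltyx] := rank_R Rxy; apply: ltn_trans ltyx.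
Qed.

(** Suppose the premise of [MBoxCas] holds at [x] while [p] fails at some [v]
    with [x R u E v], the rank of [v] being least.  Every proper successor of
    [v] then forces [BlackBox p], and [v] itself refutes [Box p], so the
    premise applies at [v] and yields [p] there. *)
Lemma MBoxCas_ranked : valid F MBoxCas.
Proof.
have [Er Es Et] := frame_E_equiv F.
move=> V x /= h.
suff main n v : (rank v < n)%N ->
    (exists2 u, frame_R F x u & frame_E F u v) -> V 0 v.
  by move=> u Rxu v Euv; apply: (main (rank v).+1) => //; exists u.
elim: n v => // n IH v ltvn [u Rxu Euv].
apply: contrapT => npv; apply/npv.
apply: (h u Rxu v Euv _ v (R_refl v) v (Er v)) => z Rvz bz y Rzy w Eyw.
have [Evz|ltzv] := rank_R Rvz.
  by case: npv; apply: bz; rewrite -Evz.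
have Rvy := R_trans Rvz Rzy.
have [y' [Ruy' Ey']] := frame_comm Euv Rvy.
apply: IH; last by exists y'; [exact: R_trans Ruy' | exact: Et Eyw].
rewrite -(rank_E Eyw); apply: leq_trans (_ : rank v <= n)%N; last by [].
have [<-//|ltyz] := rank_R Rzy.
exact: ltn_trans ltzv.
Qed.

Lemma ranked_frame_MplusGrz : MplusGrz_frame F.
Proof.
have mmF : mm_logic (valid F) by split; [exact: MK_sound|exact: closed_valid].
move=> a; apply=> // b [|->]; last exact: MBoxCas_ranked.
apply=> // c [] V x /=; last exact: grz_ranked.
- by apply; apply: R_refl.
- by move=> h y Rxy z Ryz; apply/h/(R_trans Rxy).
Qed.

End Soundness.
(** * Formulas form a countable type *)

Fixpoint tree_of_form (a : form) : GenTree.tree nat :=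
  match a with
  | Var n => GenTree.Leaf n
  | Bot => GenTree.Node 0 [::]
  | Imp b c => GenTree.Node 1 [:: tree_of_form b; tree_of_form c]
  | Box b => GenTree.Node 2 [:: tree_of_form b]
  | All b => GenTree.Node 3 [:: tree_of_form b]
  end.

Fixpoint form_of_tree (t : GenTree.tree nat) : form :=
  match t with
  | GenTree.Leaf n => Var n
  | GenTree.Node 1 [:: t1; t2] => Imp (form_of_tree t1) (form_of_tree t2)
  | GenTree.Node 2 [:: t1] => Box (form_of_tree t1)
  | GenTree.Node 3 [:: t1] => All (form_of_tree t1)
  | _ => Bot
  end.

Lemma tree_of_formK : cancel tree_of_form form_of_tree.
Proof. by elim=> //= [b -> c ->|b ->|b ->]. Qed.

HB.instance Definition _ := Countable.copy form (can_type tree_of_formK).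

(** * The canonical model of an mm-logic *)

Definition Conj (a b : form) : form := Neg (Imp a (Neg b)).

(** The substitution replacing the letters [p] and [q] of the axioms. *)
Definition subst2 (a b : form) (n : nat) : form :=
  match n with 0 => a | 1 => b | _ => Bot end.

Section Canonical.

Variable L : form -> Prop.
Hypothesis mmL : mm_logic L.

Lemma logic_mp a b : L (Imp a b) -> L a -> L b.
Proof. exact: closed_mp mmL.2 _ _. Qed.

Lemma logic_axiom a b c : MK_axiom a -> L (subst (subst2 b c) a).
Proof.
by move=> axa; apply/(closed_subst mmL.2)/mmL.1 => K axK _; apply: axK.
Qed.

Lemma logic_taut a : tautology a -> L a.
Proof. by move=> ta; apply: mmL.1 => K axK _; apply/axK/MK_taut. Qed.

Lemma logic_boxK a b : L (Imp (Box (Imp a b)) (Imp (Box a) (Box b))).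
Proof. exact: (logic_axiom a b MK_boxK). Qed.

Lemma logic_allK a b : L (Imp (All (Imp a b)) (Imp (All a) (All b))).
Proof. exact: (logic_axiom a b MK_allK). Qed.

Lemma logic_allT a : L (Imp (All a) a).
Proof. exact: (logic_axiom a a MK_allT). Qed.

Lemma logic_all4 a : L (Imp (All a) (All (All a))).
Proof. exact: (logic_axiom a a MK_all4). Qed.

Lemma logic_all5 a : L (Imp (Neg (All a)) (All (Neg (All a)))).
Proof. exact: (logic_axiom a a MK_all5). Qed.

Lemma logic_comm a : L (Imp (Box (All a)) (All (Box a))).
Proof. exact: (logic_axiom a a MK_comm). Qed.

Record theory (T : form -> Prop) : Prop := Theory {
  theory_logic : forall a, L a -> T a;
  theory_mp : forall a b, T (Imp a b) -> T a -> T b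
}.

Lemma theory_taut T a : theory T -> tautology a -> T a.
Proof. by move=> thT /logic_taut/(theory_logic thT). Qed.

Lemma theory_taut1 T a b : theory T -> tautology (Imp a b) -> T a -> T b.
Proof. by move=> thT /(theory_taut thT); apply: theory_mp. Qed.

Lemma theory_taut2 T a b c :
  theory T -> tautology (Imp a (Imp b c)) -> T a -> T b -> T c.
Proof. by move=> thT ta /(theory_taut1 thT ta); apply: theory_mp. Qed.

Record maximal_theory (T : form -> Prop) : Prop := MaximalTheory {
  maximal_theoryW :> theory T;
  maximal_consistent : ~ T Bot;
  maximal_complete : forall a, T a \/ T (Neg a)
}.

Ltac taut :=
  let v := fresh "v" in
  move=> v /=;
  repeat match goal with
  | |- context [truth v ?a] => case: (truth v a)
  | |- context [v ?a] => case: (v a)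
  end; done.

Lemma extension_theory T b : theory T -> theory (fun c => T (Imp b c)).
Proof.
move=> thT; split=> [a /(theory_logic thT)|a c].
  by apply: theory_taut1; first by []; taut.
by apply: theory_taut2; first by []; taut.
Qed.

Section Lindenbaum.

Variables (T0 : form -> Prop) (a : form).
Hypotheses (thT0 : theory T0) (T0a : ~ T0 a).

(** By the deduction theorem, [fun c => T (Imp b c)] is the theory generated by
    [T] and [b].  Since one of [Imp b a] and [Imp (Neg b) a] stays outside a
    theory that does not contain [a], avoiding [a] all along makes the limit
    complete. *)
Fixpoint lindenbaum_chain (n : nat) : form -> Prop :=
  if n isn't m.+1 then T0
  else if @unpickle form m is Some b then
    if `[< lindenbaum_chain m (Imp b a) >] then lindenbaum_chain m
    else fun c => lindenbaum_chain m (Imp b c)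
  else lindenbaum_chain m.

Lemma lindenbaum_chain_theory n : theory (lindenbaum_chain n).
Proof.
elim: n => //= n IH; case: unpickle => // b.
by case: asboolP => // _; apply: extension_theory.
Qed.

Lemma lindenbaum_chain_avoids n : ~ lindenbaum_chain n a.
Proof.
elim: n => //= n IH; case: unpickle => // b.
by case: asboolP.
Qed.

Lemma lindenbaum_chainS m n b :
  (m <= n)%N -> lindenbaum_chain m b -> lindenbaum_chain n b.
Proof.
move/subnK <-; elim: (n - m)%N => //= k IH /IH {}IH.
case: unpickle => // c; case: asboolP => // _.
by apply: theory_taut1 IH; [apply: lindenbaum_chain_theory | taut].
Qed.

Lemma lindenbaum :
  exists2 T, maximal_theory T & (forall b, T0 b -> T b) /\ ~ T a.
Proof.
pose T b := exists n, lindenbaum_chain n b.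
have Ta : ~ T a by case=> n; apply: lindenbaum_chain_avoids.
have thT : theory T.
  split=> [b Lb|b c [m Tm] [n Tn]].
    by exists 0; apply: theory_logic thT0 _ Lb.
  exists (maxn m n); apply: theory_mp (lindenbaum_chain_theory _) _ _ _ _.
    by apply: lindenbaum_chainS Tm; apply: leq_maxl.
  by apply: lindenbaum_chainS Tn; apply: leq_maxr.
have decide b : T (Imp b a) \/ T b.
  case: (pselect (lindenbaum_chain (pickle b) (Imp b a))) => h.
    by left; exists (pickle b).
  right; exists (pickle b).+1 => /=; rewrite pickleK.
  case: asboolP => // _.
  by apply: theory_taut (lindenbaum_chain_theory _) _; taut.
exists T; last by split=> // b T0b; exists 0.
split=> // [Tbot|b].
  by apply: Ta; apply: theory_taut1 Tbot; [|taut].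
case: (decide b) => [Tba|]; last by left.
case: (decide (Neg b)) => [Tnba|]; last by right.
by case: Ta; apply: theory_taut2 Tba Tnba; [|taut].
Qed.

End Lindenbaum.

Lemma box_theory T : theory T -> theory (fun a => T (Box a)).
Proof.
move=> thT; split=> [a La|a b Tab].
  exact/(theory_logic thT)/(closed_box_nec mmL.2).
have hK := theory_logic thT (logic_boxK a b).
exact (theory_mp thT (theory_mp thT hK Tab)).
Qed.

Lemma all_theory T : theory T -> theory (fun a => T (All a)).
Proof.
move=> thT; split=> [a La|a b Tab].
  exact/(theory_logic thT)/(closed_all_nec mmL.2).
have hK := theory_logic thT (logic_allK a b).
exact (theory_mp thT (theory_mp thT hK Tab)).
Qed.

Definition world := {T : form -> Prop | maximal_theory T}.

Definition holds (x : world) : form -> Prop := sval x.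

Lemma world_maximal x : maximal_theory (holds x).
Proof. exact: svalP. Qed.

Lemma world_theory x : theory (holds x).
Proof. exact: (world_maximal x). Qed.

Lemma world_logic x a : L a -> holds x a.
Proof. exact: theory_logic (world_theory x) _. Qed.

Lemma world_imp x a b : holds x (Imp a b) <-> (holds x a -> holds x b).
Proof.
have thx := world_theory x; split=> [|h]; first exact: theory_mp.
have [/h xb|xna] := maximal_complete (world_maximal x) a.
  by apply: theory_taut1 xb; [|taut].
by apply: theory_taut1 xna; [|taut].
Qed.

Lemma world_mp x a b : L (Imp a b) -> holds x a -> holds x b.
Proof. by move/(world_logic x)/world_imp. Qed.

Lemma world_neg x a : holds x (Neg a) <-> ~ holds x a.
Proof.
rewrite world_imp; split=> h /h //.
exact: maximal_consistent (world_maximal x).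
Qed.

Lemma world_extends T a : theory T -> ~ T a ->
  exists2 x : world, (forall b, T b -> holds x b) & ~ holds x a.
Proof.
move=> thT /(lindenbaum thT)[U mU [TU Ua]].
by exists (exist _ U mU).
Qed.

Definition canonical_R (x y : world) : Prop :=
  forall a, holds x (Box a) -> holds y a.

Definition canonical_E (x y : world) : Prop :=
  forall a, holds x (All a) -> holds y a.

Lemma canonical_E_all x y a :
  canonical_E x y -> (holds x (All a) <-> holds y (All a)).
Proof.
move=> Exy; split=> [xa|ya].
  exact/Exy/(world_mp (logic_all4 a)).
apply: contrapT => /world_neg xna.
have /Exy/world_neg[] // : holds x (All (Neg (All a))).
by apply/(world_imp _ _ _).1: xna; apply/world_logic/logic_all5.
Qed.

Lemma canonical_E_equiv : Equivalence canonical_E.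
Proof.
have T x a : holds x (All a) -> holds x a := world_mp (logic_allT a).
split=> [x a /T //|x y Exy a /(canonical_E_all _ Exy)/T //|x y z Exy Eyz a].
by move/(canonical_E_all _ Exy)/Eyz.
Qed.

(** The required [w] extends the theory generated by the boxed formulas of [x]
    and the [All]-formulas of [z].  It is consistent: if [Box (Neg (All s))]
    belonged to [x] for some [All s] in [z], then, [Neg (All s)] being
    equivalent to its own [All]-closure, the commutation axiom would put
    [All (Box (Neg (All s)))] in [x] and hence [Neg (All s)] in [z]. *)
Lemma canonical_comm x y z : canonical_E x y -> canonical_R y z ->
  exists w, canonical_R x w /\ canonical_E w z.
Proof.
move=> Exy Ryz.
pose T b := exists2 s, holds z (All s) & holds x (Box (Imp (All s) b)).
have [Er Es Et] := canonical_E_equiv.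
have thz := world_theory z.
have bx := box_theory (world_theory x).
have az := all_theory thz.
pose top := Imp Bot Bot.
have ztop : holds z (All top) by apply: theory_taut az _; taut.
have thT : theory T.
  split=> [a La|a b [s zs xs] [t zt xt]].
    exists top => //; apply: (theory_taut1 bx) (theory_logic bx La); taut.
  exists (Conj s t).
    by apply: (theory_taut2 az) zs zt; taut.
  apply: (theory_mp bx) xt; apply: (theory_mp bx) xs.
  apply: (theory_logic bx).
  have allC u : tautology (Imp (Conj s t) u) -> L (Imp (All (Conj s t)) (All u)).
    by move/logic_taut/(closed_all_nec mmL.2)/(logic_mp (logic_allK _ _)).
  have thL : theory L by split=> //; apply: logic_mp.
  have Ls : L (Imp (All (Conj s t)) (All s)) by apply: allC; taut.
  have Lt : L (Imp (All (Conj s t)) (All t)) by apply: allC; taut.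
  by apply: (theory_taut2 thL) Ls Lt; taut.
have Tbot : ~ T Bot.
  case=> s zs xs.
  have {}xs : holds x (Box (All (Neg (All s)))).
    by apply: (theory_mp bx) xs; apply/(theory_logic bx)/logic_all5.
  have {xs} : holds x (All (Box (Neg (All s)))).
    exact: world_mp (logic_comm _) xs.
  by move/Exy/Ryz/world_neg.
have [w Tw _] := world_extends thT Tbot.
exists w; split=> [a xa|].
  by apply: Tw; exists top => //; apply: (theory_taut1 bx) xa; taut.
apply: Es => a za; have aw := world_theory w.
apply: world_mp (logic_allT a) _.
by apply: Tw; exists a => //; apply: (theory_taut bx); taut.
Qed.

Definition canonical_frame (x : world) : augmented_frame world :=
  {| frame_nonempty := inhabits x;
     frame_R := canonical_R;
     frame_E := canonical_E;
     frame_E_equiv := canonical_E_equiv;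
     frame_comm := canonical_comm |}.

Definition canonical_valuation (n : nat) (x : world) : Prop := holds x (Var n).

Lemma canonical_truth x0 x a :
  sat (canonical_frame x0) canonical_valuation x a <-> holds x a.
Proof.
elim: a x => //= [|b IHb c IHc|b IHb|b IHb] x.
- by split=> // /(maximal_consistent (world_maximal x)).
- by rewrite world_imp IHb IHc.
- split=> [h|xb y Rxy]; last exact/IHb/Rxy.
  apply: contrapT => /(world_extends (box_theory (world_theory x)))[y Rxy] [].
  exact/IHb/h.
- split=> [h|xb y Exy]; last exact/IHb/Exy.
  apply: contrapT => /(world_extends (all_theory (world_theory x)))[y Exy] [].
  exact/IHb/h.
Qed.

End Canonical.

(** A model is tight when its accessibility relation is as large as the boxed
    formulas allow; modal axioms true throughout a tight model then yield
    first-order properties of the relation. *)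
Definition tight (W : Type) (F : augmented_frame W) (V : nat -> W -> Prop) :=
  forall x y, (forall a, sat F V x (Box a) -> sat F V y a) -> frame_R F x y.

Theorem canonical_model L phi : mm_logic L -> ~ L phi ->
  exists (W : Type) (F : augmented_frame W) (V : nat -> W -> Prop),
    [/\ tight F V, forall a x, L a -> sat F V x a &
        exists x, ~ sat F V x phi].
Proof.
move=> mmL nLphi.
have thL : theory L L by split=> //; exact: closed_mp mmL.2.
have [x0 _ nx0] := world_extends mmL thL nLphi.
exists (world L), (canonical_frame mmL x0), (@canonical_valuation L).
split=> [x y h a xa|a x La|].
- by apply/canonical_truth/h/canonical_truth.
- exact/canonical_truth/(world_logic x La).
- by exists x0 => /canonical_truth.
Qed.
(** * Cluster types in a tight model of the logic *)

Fixpoint subformulas (a : form) : seq form :=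
  a :: match a with
       | Imp b c => subformulas b ++ subformulas c
       | Box b => subformulas b
       | All b => subformulas b
       | _ => [::]
       end.

Lemma subformulas_refl a : a \in subformulas a.
Proof. by case: a => *; rewrite /= inE eqxx. Qed.

Lemma subformulas_trans a b :
  a \in subformulas b -> {subset subformulas a <= subformulas b}.
Proof.
elim: b => [n||b IHb c IHc|b IHb|b IHb] /=;
  try by rewrite inE => /eqP->.
all: rewrite inE => /orP[/eqP-> //|].
- rewrite mem_cat => /orP[/IHb|/IHc] h d /h hd; rewrite inE mem_cat hd !orbT //.
- by move/IHb => h d /h hd; rewrite inE hd orbT.
- by move/IHb => h d /h hd; rewrite inE hd orbT.
Qed.

Section Model.

Variables (W : Type) (F : augmented_frame W) (V : nat -> W -> Prop).
Hypothesis tightF : tight F V.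
Hypothesis true_MplusGrz : forall a x, MplusGrz a -> sat F V x a.

Local Notation R := (frame_R F).
Local Notation E := (frame_E F).

Lemma E_refl x : E x x.
Proof. by case: (frame_E_equiv F) => h _ _; apply: h. Qed.

Lemma E_sym x y : E x y -> E y x.
Proof. by case: (frame_E_equiv F) => _ h _; apply: h. Qed.

Lemma E_trans y x z : E x y -> E y z -> E x z.
Proof. by case: (frame_E_equiv F) => _ _ h; apply: h. Qed.

Lemma MGrz_MplusGrz a : MGrz_axiom a -> MplusGrz a.
Proof.
by move=> axa L mmL gen; apply: gen; left => K mmK genK; apply: genK.
Qed.

Lemma MBoxCas_MplusGrz : MplusGrz MBoxCas.
Proof. by move=> L mmL gen; apply: gen; right. Qed.

Lemma true_instance a s x : MplusGrz a -> sat F V x (subst s a).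
Proof.
move=> La; apply: true_MplusGrz => L mmL gen.
apply: (closed_subst mmL.2); exact: La.
Qed.

Lemma model_refl x : R x x.
Proof.
apply: tightF => a; exact: true_instance (fun=> a) x (MGrz_MplusGrz MGrz_T).
Qed.

Lemma model_trans y x z : R x y -> R y z -> R x z.
Proof.
move=> Rxy Ryz; apply: tightF => a xa.
have /= h := true_instance (fun=> a) x (MGrz_MplusGrz MGrz_4).
exact: h xa y Rxy z Ryz.
Qed.

(** The schemata [grz] and [MBoxCas] hold for the sets of points defined by
    formulas only, which is why definability has to be tracked. *)
Definition definable (P : W -> Prop) : Prop :=
  exists a, forall x, sat F V x a <-> P x.

Lemma definable_ext P Q :
  definable P -> (forall x, P x <-> Q x) -> definable Q.
Proof. by move=> [a aP] PQ; exists a => x; rewrite aP. Qed.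

Lemma definable_sat a : definable (fun x => sat F V x a).
Proof. by exists a. Qed.

Lemma definable_imp P Q :
  definable P -> definable Q -> definable (fun x => P x -> Q x).
Proof. by move=> [a aP] [b bQ]; exists (Imp a b) => x /=; rewrite aP bQ. Qed.

Lemma definable_cst (A : Prop) : definable (fun=> A).
Proof.
case: (pselect A) => hA; first by exists (Imp Bot Bot) => x /=; split.
by exists Bot => x /=; split.
Qed.

Lemma definable_not P : definable P -> definable (fun x => ~ P x).
Proof. by move=> dP; exact (definable_imp dP (definable_cst False)). Qed.

Lemma definable_and P Q :
  definable P -> definable Q -> definable (fun x => P x /\ Q x).
Proof.
move=> dP dQ.
have := definable_not (definable_imp dP (definable_not dQ)).
move/definable_ext; apply=> x; split=> [/not_implyP[Px /contrapT]|[Px Qx]] //.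
by move=> h; apply: h.
Qed.

Lemma definable_iff P Q :
  definable P -> definable Q -> definable (fun x => P x <-> Q x).
Proof.
by move=> dP dQ; apply: definable_and; apply: definable_imp.
Qed.

Lemma definable_box P :
  definable P -> definable (fun x => forall y, R x y -> P y).
Proof.
by move=> [a aP]; exists (Box a) => x /=; split=> h y /h; rewrite aP.
Qed.

Lemma definable_ex P :
  definable P -> definable (fun x => exists2 y, E x y & P y).
Proof.
move=> [a aP]; exists (Neg (All (Neg a))) => x /=; split=> [h|[y Exy Py] h].
  by apply: contrapT => nP; apply: h => y Exy /aP Py; apply: nP; exists y.
exact/(h y)/aP.
Qed.

Lemma definable_forall (T : finType) (P : T -> W -> Prop) :
  (forall t, definable (P t)) -> definable (fun x => forall t, P t x).
Proof.
move=> dP.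
suff : definable (fun x => forall t, t \in enum T -> P t x).
  move/definable_ext; apply=> x; split=> h t //; apply: h.
  by rewrite mem_enum.
elim: (enum T) => [|t s IH].
  by apply: definable_ext (definable_cst True) _ => x; split.
apply: definable_ext (definable_and (dP t) IH) _ => x; split.
  by move=> [Ptx h] u; rewrite inE => /orP[/eqP->|/h].
by move=> h; split=> [|u us]; apply: h; rewrite inE ?eqxx ?us ?orbT.
Qed.

(** This is [grz] in contrapositive form, its letter standing for the complement
    of [P].  It serves as a choice of a maximal point of [P]. *)
Lemma grz_maximal P x : definable P -> P x ->
  exists y, [/\ R x y, P y &
    forall u, R y u -> ~ P u -> forall v, R u v -> ~ P v].
Proof.
move=> /definable_not[a aP] Px; apply: contrapT => no.
have /= := @true_instance _ (fun=> a) x (MGrz_MplusGrz MGrz_grz).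
have /[swap]/[apply] : forall y, R x y ->
    (forall u, R y u -> sat F V u a -> forall v, R u v -> sat F V v a) ->
    sat F V y a.
  move=> y Rxy h; apply/aP => Py; apply: no; exists y; split=> // u Ryu nPu v.
  by move=> Ruv; apply/aP; apply: h Ryu _ _ Ruv; apply/aP.
by move/aP; apply.
Qed.

(** The accessibility relation of [BlackBox]. *)
Definition Q (x y : W) : Prop := exists2 u, R x u & E u y.

Lemma R_Q x y : R x y -> Q x y.
Proof. by exists y => //; apply: E_refl. Qed.

Lemma Q_trans y x z : Q x y -> Q y z -> Q x z.
Proof.
move=> [u Rxu Euy] [v Ryv Evz]; have [w [Ruw Ewv]] := frame_comm Euy Ryv.
by exists w; [exact: model_trans Ruw | exact: E_trans Evz].
Qed.

Lemma E_Q x y : E x y -> Q x y.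
Proof. by exists x => //; apply: model_refl. Qed.

(** The contrapositive of [MBoxCas], with [P] for its letter. *)
Lemma cas_maximal P x y : definable P -> Q x y -> ~ P y ->
  exists z, [/\ Q x z, exists2 t, Q z t & ~ P t &
    forall u, R z u -> (forall v, R u v -> P v) -> forall v, Q u v -> P v].
Proof.
move=> [a aP] [x' Rxx' Ex'y] nPy; apply: contrapT => no.
have /= := @true_instance _ (fun=> a) x MBoxCas_MplusGrz.
have /[swap]/[apply] : forall x', R x x' -> forall z, E x' z ->
    (forall u, R z u -> (forall v, R u v -> sat F V v a) ->
       forall v, R u v -> forall w, E v w -> sat F V w a) ->
    forall t, R z t -> forall w, E t w -> sat F V w a.
  move=> y' Rxy' z Ey'z h t Rzt w Etw; apply/aP; apply: contrapT => nPw.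
  apply: no; exists z; split; [by exists y' | by exists w => //; exists t |].
  move=> u Rzu hu v [t' Rut' Et'v]; apply/aP; apply: h Rzu _ _ Rut' _ Et'v.
  by move=> v' /hu/aP.
by move=> /(_ _ Rxx' _ Ex'y)/aP.
Qed.

Variable phi : form.

Definition signature := seq_sub (subformulas phi).

Definition type_of (x : W) : {set signature} :=
  [set s | `[< sat F V x (val s) >]].

Definition cluster_of (x : W) : {set {set signature}} :=
  [set t | `[< exists2 y, E x y & type_of y = t >]].

Lemma in_type x s : s \in type_of x <-> sat F V x (val s).
Proof. by rewrite inE; split=> /asboolP. Qed.

Lemma in_cluster x t :
  t \in cluster_of x <-> exists2 y, E x y & type_of y = t.
Proof. by rewrite inE; split=> /asboolP. Qed.

Lemma type_sat x y a : a \in subformulas phi -> type_of x = type_of y ->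
  sat F V x a <-> sat F V y a.
Proof. by move=> ha exy; rewrite -!(in_type _ (SeqSub ha)) exy. Qed.

Lemma cluster_E x y : E x y -> cluster_of x = cluster_of y.
Proof.
move=> Exy; apply/setP => t; apply/idP/idP => /in_cluster[z Ez <-];
  apply/in_cluster; exists z => //.
- exact: E_trans (E_sym Exy) Ez.
- exact: E_trans Ez.
Qed.

Lemma definable_type t : definable (fun x => type_of x = t).
Proof.
have := @definable_forall signature _ (fun s => definable_iff
  (definable_sat (val s)) (definable_cst (s \in t))).
move/definable_ext; apply=> x; split=> [h|<- s]; last by rewrite in_type.
by apply/setP => s; apply/idP/idP => [/in_type/h//|/h/in_type].
Qed.

Lemma definable_cluster g : definable (fun x => cluster_of x = g).
Proof.
have := @definable_forall {set signature} _ (fun t => definable_iff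
  (definable_ex (definable_type t)) (definable_cst (t \in g))).
move/definable_ext; apply=> x; split=> [h|<- t]; last by rewrite in_cluster.
by apply/setP => t; apply/idP/idP => [/in_cluster/h//|/h/in_cluster].
Qed.

Definition final (g : {set {set signature}}) (x : W) : Prop :=
  forall y, R x y -> cluster_of y = g -> type_of y = type_of x.

Lemma definable_final g : definable (final g).
Proof.
have := @definable_forall {set signature} _ (fun t => definable_imp
  (definable_type t) (definable_box
    (definable_imp (definable_cluster g) (definable_type t)))).
by move/definable_ext; apply=> x; split=> [h|h t <-]; [exact: h|].
Qed.

(** Induction on the number of types met above [x] inside the cluster type.  By
    [grz_maximal], [x] sees a point [y] of the same cluster type and type such
    that this combination, once left, never recurs.  If [y] is not final, it
    sees a point that still has cluster type [g] but has lost the type of [x]. *)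
Lemma exists_final g x : cluster_of x = g ->
  exists y, [/\ R x y, cluster_of y = g & final g y].
Proof.
pose N y : {set {set signature}} :=
  [set t | `[< exists u, [/\ R y u, cluster_of u = g & type_of u = t] >]].
have NP y t :
    t \in N y <-> exists u, [/\ R y u, cluster_of u = g & type_of u = t].
  by rewrite inE; split=> /asboolP.
have [n] := ubnP #|N x|; elim: n x => // n IH x ltNx gx.
have dP := definable_and (definable_cluster g) (definable_type (type_of x)).
have [y [Rxy [gy ty] leave]] := grz_maximal dP (conj gx erefl).
case: (pselect (final g y)) => [fy|]; first by exists y.
move/existsNP => [u /not_implyP[Ryu /not_implyP[gu tu]]].
have Rxu := model_trans Rxy Ryu.
have NuNx : N u \proper N x.
  apply/properP; split.
    apply/subsetP => t /NP[v [Ruv gv tv]]; apply/NP; exists v.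
    by split=> //; apply: model_trans Ruv.
  exists (type_of x); first by apply/NP; exists x; split=> //; apply: model_refl.
  apply/negP => /NP[v [Ruv gv tv]]; apply: leave Ryu _ _ Ruv (conj gv tv).
  by move=> [_ tux]; apply: tu; rewrite tux.
have [|//|z [Ruz gz fz]] := IH u; first exact: leq_trans (proper_card NuNx) _.
by exists z; split=> //; apply: model_trans Ruz.
Qed.

(** This is where [MBoxCas] enters, its letter [p] being false exactly at the
    points of cluster type [g] that are not final.  Every successor of a final
    point that has cluster type [g] is final again, so a final point satisfies
    [Box p]; above the point given by [cas_maximal] it then satisfies
    [BlackBox p]. *)
Lemma exists_all_final g x : cluster_of x = g ->
  exists y, [/\ Q x y, cluster_of y = g &
    forall z, Q y z -> cluster_of z = g -> final g z].
Proof.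
move=> gx; pose P z := cluster_of z = g -> final g z.
have dP : definable P := definable_imp (definable_cluster g) (definable_final g).
case: (pselect (forall z, Q x z -> P z)) => [h|].
  by exists x; split=> //; apply/R_Q/model_refl.
move=> /existsNP[z /not_implyP[Qxz nPz]].
have [y [Qxy [t [y0 Ryy0 Ey0t] nPt] max]] := cas_maximal dP Qxz nPz.
have gy0 : cluster_of y0 = g.
  rewrite (cluster_E Ey0t); apply: contrapT => ngt.
  by apply: nPt => /ngt.
have [u [Ry0u gu fu]] := exists_final gy0.
have Ryu := model_trans Ryy0 Ry0u.
exists u; split=> //; first exact: Q_trans Qxy (R_Q Ryu).
move=> v; apply: max Ryu _ v => v Ruv gv w Rvw gw.
by rewrite (fu v Ruv gv) (fu w _ gw) //; apply: model_trans Rvw.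
Qed.

(** The [E]-class of a good point can be copied as an antichain of types: a step
    from it either changes nothing that the types record, or leaves the cluster
    type for ever. *)
Definition good (x : W) : Prop :=
  forall t, E x t -> final (cluster_of x) t /\
    forall u, R t u -> cluster_of u <> cluster_of x ->
      forall v, R u v -> cluster_of v <> cluster_of x.

Lemma exists_good x :
  exists y, [/\ Q x y, cluster_of y = cluster_of x & good y].
Proof.
have [y [Qxy gy fin]] := exists_all_final (erefl (cluster_of x)).
have [z [Ryz gz leave]] := grz_maximal (definable_cluster _) gy.
exists z; split=> //; first exact: Q_trans Qxy (R_Q Ryz).
move=> t Ezt; rewrite gz; split=> [|u Rtu gu v Ruv gv].
  apply: fin; first by exists z.
  by rewrite -(cluster_E Ezt).
have [u' [Rzu' Eu'u]] := frame_comm Ezt Rtu.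
have [v' [Ru'v' Ev'v]] := frame_comm Eu'u Ruv.
apply: (leave u' Rzu' _ v' Ru'v').
  by rewrite (cluster_E Eu'u).
by rewrite (cluster_E Ev'v).
Qed.

Definition reach (x : W) : {set {set {set signature}}} :=
  [set g | `[< exists2 y, R x y & cluster_of y = g >]].

Lemma in_reach x g : g \in reach x <-> exists2 y, R x y & cluster_of y = g.
Proof. by rewrite inE; split=> /asboolP. Qed.

Lemma reach_Q x y : Q x y -> reach y \subset reach x.
Proof.
move=> [z Rxz Ezy]; apply/subsetP => g /in_reach[u Ryu gu].
have [w [Rzw Ewu]] := frame_comm Ezy Ryu.
by apply/in_reach; exists w; [exact: model_trans Rzw | rewrite (cluster_E Ewu)].
Qed.

(** The rank is the least size of [reach] over all realizations.  Passing to a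
    good point above a least one does not enlarge [reach], so good points attain
    the minimum. *)
Lemma exists_rank : exists rk : {set {set signature}} -> nat,
  forall x, (rk (cluster_of x) <= #|reach x|)%N /\
    exists y, [/\ cluster_of y = cluster_of x, good y &
                  #|reach y| = rk (cluster_of x)].
Proof.
have /choice[rk rkP] : forall g, exists n, forall x, cluster_of x = g ->
    (n <= #|reach x|)%N /\
    exists y, [/\ cluster_of y = g, good y & #|reach y| = n].
  move=> g; case: (pselect (exists x, cluster_of x = g)) => [[x0 gx0]|no].
    pose pr n := `[< exists2 y, cluster_of y = g & #|reach y| = n >].
    have expr : exists n, pr n by exists #|reach x0|; apply/asboolP; exists x0.
    have [n /asboolP[y gy ny] min] := ex_minnP expr.
    exists n => x gx; split; first by apply: min; apply/asboolP; exists x.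
    have [z [Qyz gz goodz]] := exists_good y; exists z.
    split=> //; first by rewrite gz.
    apply/eqP; rewrite eqn_leq -{1}ny subset_leq_card ?reach_Q //=.
    by apply: min; apply/asboolP; exists z => //; rewrite gz.
  by exists 0 => x gx; case: no; exists x.
by exists rk => x; apply: rkP.
Qed.

(** * The finite frame of cluster types *)

(** The first component is a cluster type, the second a type in it. *)
Definition realized (m : {set {set signature}} * {set signature}) : bool :=
  `[< exists x, cluster_of x = m.1 /\ type_of x = m.2 >].

Definition node : Type := {m | realized m}.
HB.instance Definition _ := Finite.on node.

Definition cluster (m : node) : {set {set signature}} := (val m).1.

Definition type (m : node) : {set signature} := (val m).2.

Definition realizes (x : W) (m : node) : Prop :=
  cluster_of x = cluster m /\ type_of x = type m.

Lemma node_realized m : exists x, realizes x m.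
Proof. by have /asboolP[x] := valP m; exists x. Qed.

Lemma realized_node x : exists m, realizes x m.
Proof.
have rx : realized (cluster_of x, type_of x) by apply/asboolP; exists x.
by exists (Sub _ rx).
Qed.

Lemma node_eq m n : cluster m = cluster n -> type m = type n -> m = n.
Proof.
move=> gmn tmn; apply: val_inj.
by apply/eqP; rewrite -pair_eqE; apply/andP; split; apply/eqP.
Qed.

(** Modal compatibility of types: what a step between two points of the model
    imposes on their types. *)
Definition box_le (s t : {set signature}) : Prop :=
  forall (b : signature) a, val b = Box a -> b \in s -> b \in t.

Lemma box_le_trans t s u : box_le s t -> box_le t u -> box_le s u.
Proof. by move=> st tu b a eb /(st b a eb)/(tu b a eb). Qed.

Lemma R_box_le x y : R x y -> box_le (type_of x) (type_of y).
Proof.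
move=> Rxy b a eb; rewrite !in_type eb => h z Ryz.
exact/h/(model_trans Rxy).
Qed.

Variable rk : {set {set signature}} -> nat.
Hypothesis rk_le : forall x, (rk (cluster_of x) <= #|reach x|)%N.
Hypothesis rk_good : forall x, exists y,
  [/\ cluster_of y = cluster_of x, good y & #|reach y| = rk (cluster_of x)].

(** The last clause is what commutativity demands of the whole [E]-class; the
    drop in rank makes [node_R] antisymmetric and keeps proper
    successors out of the [E]-class. *)
Definition node_R (m n : node) : Prop :=
  m = n \/
  [/\ (rk (cluster n) < rk (cluster m))%N,
      box_le (type m) (type n) &
      forall s, s \in cluster m -> exists2 t, t \in cluster n & box_le s t].

Definition node_E (m n : node) : Prop := cluster m = cluster n.

Lemma node_R_refl : Reflexive node_R.
Proof. by left. Qed.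

Lemma node_R_trans : Transitive node_R.
Proof.
move=> l m n [->//|[rlm blm clm]] [<-|[rmn bmn cmn]]; first by right.
right; split; first exact: ltn_trans rlm.
  exact: box_le_trans bmn.
move=> s /clm[t /cmn[u un tu] st]; exists u => //.
exact: box_le_trans tu.
Qed.

Lemma node_E_equiv : Equivalence node_E.
Proof. by split=> [m|m n|l m n]; rewrite /node_E => // -> ->. Qed.

(** The last clause of [node_R] speaks of all the types in the cluster type of
    [n], hence of the type of any [m] in its [E]-class. *)
Lemma node_comm m n o : node_E m n -> node_R n o ->
  exists l, node_R m l /\ node_E l o.
Proof.
rewrite /node_E => gmn [<-|[rno bno cno]].
  by exists m; split; first exact: node_R_refl.
have [x [gx tx]] := node_realized m.
have /cno[t to mt] : type m \in cluster n.
  rewrite -gmn -gx -tx; apply/in_cluster; exists x => //; exact: E_refl.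
have [y [gy _]] := node_realized o.
have /in_cluster[z Eyz tz] : t \in cluster_of y by rewrite gy.
have [l [gl tl]] := realized_node z.
have glo : cluster l = cluster o by rewrite -gl -gy (cluster_E Eyz).
exists l; split=> //; right; split; rewrite ?glo ?gmn //.
by rewrite -tl tz.
Qed.

Lemma node_inhabited : inhabited node.
Proof.
by have [x] := frame_nonempty F; have [m _] := realized_node x; split.
Qed.

Definition node_frame : augmented_frame node :=
  {| frame_nonempty := node_inhabited;
     frame_R := node_R;
     frame_E := node_E;
     frame_E_equiv := node_E_equiv;
     frame_comm := node_comm |}.

Definition node_valuation (k : nat) (m : node) : Prop :=
  exists2 s, s \in type m & val s = Var k.

Lemma realizes_sat x y m a : a \in subformulas phi ->
  realizes x m -> realizes y m -> sat F V x a <-> sat F V y a.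
Proof. by move=> ha [_ tx] [_ ty]; apply: type_sat ha _; rewrite tx ty. Qed.

(** A point that refutes [Box b] but not [b] has the type of a point [t] in a
    good [E]-class of least rank.  A successor of [t] refuting [b] has another
    type than [t], so by finality it lies in another cluster type, from which
    that of [t] is out of reach: its rank is smaller. *)
Lemma node_box_witness x m b : Box b \in subformulas phi -> realizes x m ->
  sat F V x b -> ~ sat F V x (Box b) ->
  exists n y, [/\ node_R m n, realizes y n & ~ sat F V y b].
Proof.
move=> hB [gx tx] xb nxB.
have hb : b \in subformulas phi.
  by apply: subformulas_trans hB _ _; rewrite /= inE subformulas_refl orbT.
have [z [gz goodz rz]] := rk_good x.
have /in_cluster[t Ezt tt] : type_of x \in cluster_of z.
  by rewrite gz; apply/in_cluster; exists x => //; apply: E_refl.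
have [fin leave] := goodz t Ezt.
have : ~ sat F V t (Box b) by rewrite (type_sat hB tt).
move=> /existsNP[u /not_implyP[Rtu nub]].
have gu : cluster_of u <> cluster_of z.
  move=> gu; apply: nub; apply/(type_sat hb (fin u Rtu gu)).
  by apply/(type_sat hb tt).
have [n un] := realized_node u.
exists n, u; split=> //; right; case: un => gn tn.
rewrite -gn -tn -gx -tx; split.
- apply: leq_ltn_trans (rk_le u) _; rewrite -rz; apply: proper_card.
  apply/properP; split.
    exact/reach_Q/(Q_trans (E_Q Ezt))/R_Q.
  exists (cluster_of z); first by apply/in_reach; exists z => //; apply: model_refl.
  by apply/negP => /in_reach[v Ruv gv]; apply: leave Rtu gu v Ruv gv.
- by rewrite -tt; apply: R_box_le.
- move=> s; rewrite -gz => /in_cluster[y Ezy <-].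
  have [v [Ryv Evu]] := frame_comm (E_trans (E_sym Ezy) Ezt) Rtu.
  exists (type_of v); last exact: R_box_le.
  by apply/in_cluster; exists v => //; apply: E_sym.
Qed.

Lemma node_truth a m x : a \in subformulas phi -> realizes x m ->
  sat node_frame node_valuation m a <-> sat F V x a.
Proof.
elim: a m x => [k||b IHb c IHc|b IHb|b IHb] m x ha xm.
- case: (xm) => _ tx /=; split=> [[s]|xk]; last first.
    by exists (SeqSub ha) => //; rewrite -tx; apply/in_type.
  by rewrite -tx => /in_type /[swap] ->.
- by [].
- have hb : b \in subformulas phi.
    by apply: subformulas_trans ha _ _; rewrite /= inE mem_cat subformulas_refl orbT.
  have hc : c \in subformulas phi.
    by apply: subformulas_trans ha _ _; rewrite /= inE mem_cat subformulas_refl !orbT.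
  by rewrite /= (IHb _ _ hb xm) (IHc _ _ hc xm).
- have hb : b \in subformulas phi.
    by apply: subformulas_trans ha _ _; rewrite /= inE subformulas_refl orbT.
  split=> [h|xB n].
    have xb : sat F V x b by apply/(IHb _ _ hb xm)/h/node_R_refl.
    apply: contrapT => /(node_box_witness ha xm xb)[n [y [Rmn yn]]] [].
    exact/(IHb _ _ hb yn)/h.
  have [y yn] := node_realized n; move=> Rmn; apply/(IHb _ _ hb yn).
  case: Rmn => [emn|[_ bmn _]].
    apply/(realizes_sat (y := x) hb yn); first by rewrite -emn.
    exact/xB/model_refl.
  have : SeqSub ha \in type n.
    by apply: (bmn _ b) => //; case: xm => _ <-; apply/in_type.
  by case: yn => _ <- /in_type /= yB; apply/yB/model_refl.
- have hb : b \in subformulas phi.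
    by apply: subformulas_trans ha _ _; rewrite /= inE subformulas_refl orbT.
  case: (xm) => gx tx; split=> [h y Exy|xA n gmn].
    have [n yn] := realized_node y; apply/(IHb _ _ hb yn)/h.
    by case: yn => gn _; rewrite /= /node_E -gx -gn (cluster_E Exy).
  have [y [gy ty]] := node_realized n.
  have /in_cluster[z Exz tz] : type n \in cluster_of x.
    rewrite gx gmn -gy; apply/in_cluster; exists y => //; exact: E_refl.
  have zn : realizes z n by split; rewrite // -(cluster_E Exz) gx gmn.
  exact/(IHb _ _ hb zn)/xA.
Qed.

Lemma node_frame_MplusGrz : MplusGrz_frame node_frame.
Proof.
apply: (ranked_frame_MplusGrz (rank := fun m => rk (cluster m))).
- exact: node_R_refl.
- exact: node_R_trans.
- by move=> m n /= ->.
- by move=> m n [->|[]]; [left | right].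
Qed.

End Model.

Theorem theorem6p16 (phi : form) :
  ~ MplusGrz phi ->
  exists (W : finType) (F : augmented_frame W),
    MplusGrz_frame F /\ ~ valid F phi.
Proof.
have mmL : mm_logic MplusGrz.
  split=> [a Ka L mmL _|]; first exact: mmL.1.
  split=> [s a La|a b Lab La|a La|a La] L mmL gen.
  - exact: closed_subst mmL.2 _ _ (La L mmL gen).
  - exact: closed_mp mmL.2 _ _ (Lab L mmL gen) (La L mmL gen).
  - exact: closed_box_nec mmL.2 _ (La L mmL gen).
  - exact: closed_all_nec mmL.2 _ (La L mmL gen).
move=> /(canonical_model mmL)[W [F [V [tightF trueL [x nx]]]]].
have [rk rkP] := exists_rank tightF trueL phi.
have rk_le y := (rkP y).1; have rk_good y := (rkP y).2.
exists (node F V phi), (node_frame F V rk).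
split; first exact: node_frame_MplusGrz.
have [m xm] := realized_node F V phi x.
have truth := node_truth tightF trueL rk_le rk_good (subformulas_refl _) xm.
by move=> valid_phi; apply/nx/truth/valid_phi.
Qed.
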